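(* With $\omega_{(1)}=(4,4,3)$, $\omega_{(2)}=(4,4,1,1)$, $\omega_{(3)}=(4,2,2,1)$, $\omega_{(4)}=(4,2,4)$, one has $\dim QP_5^+(\omega_{(1)})=75$, $\dim QP_5^+(\omega_{(2)})=145$, $\dim QP_5^+(\omega_{(3)})=390$, $\dim QP_5^+(\omega_{(4)})=1$.
   Context: $P_k=\mathbb F_2[x_1,\dots,x_k]$, $\deg x_j=1$, a module over the mod-2 Steenrod algebra $\mathcal A$ with augmentation ideal $\mathcal A^+$. $P_k^+$ is the span of monomials $x_1^{a_1}\cdots x_k^{a_k}$ with all $a_j>0$. For a monomial $x$ with exponents $\nu_j(x)$, its weight vector is $\omega(x)=(\omega_1(x),\omega_2(x),\dots)$, $\omega_i(x)=\sum_{j}\alpha_{i-1}(\nu_j(x))$, $\alpha_t(a)$ the $t$-th binary digit of $a$. For a weight vector $\omega$, $\deg\omega=\sum_i2^{i-1}\omega_i$, weight vectors ordered left-lexicographically; $P_k(\omega)$ is spanned by monomials $y$ of degree $\deg\omega$ with $\omega(y)\le\omega$, $P_k^-(\omega)$ by those with $\omega(y)<\omega$; $QP_k^+(\omega)=(P_k^+\cap P_k(\omega))/\big((\mathcal A^+P_k\cap P_k^+\cap P_k(\omega))+(P_k^+\cap P_k^-(\omega))\big)$. *)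

(* Defs.v *)
(* Degree-d homogeneous part of P_k = F_2[x_1..x_k] modelled as
   the F_2-vector space of functions (Mon k d) -> F_2, i.e. coefficient vectors
   on the basis of monomials of degree d. *)
From HB Require Import structures.
From mathcomp Require Import all_boot all_order all_algebra.
Set Implicit Arguments. Unset Strict Implicit. Unset Printing Implicit Defensive.
Import GRing.Theory.
Local Open Scope ring_scope.

Definition Expo (k d : nat) : finType := {ffun 'I_k -> 'I_d.+1}.

Definition edeg k d (a : Expo k d) : nat := (\sum_(j < k) (a j : nat))%N.

Definition Mon (k d : nat) : finType := {a : Expo k d | edeg a == d}.

Definition Pd (k d : nat) := {ffun Mon k d -> ('F_2)^o}.

Definition mono k d (b : Mon k d) : Pd k d := [ffun c => ((c == b)%:R : ('F_2)^o)].

Definition alpha (t a : nat) : nat := ((a %/ 2 ^ t) %% 2)%N.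

(* weight vector, 0-indexed: wt b i = omega_{i+1}(b) *)
Definition wt k d (b : Mon k d) (i : nat) : nat :=
  (\sum_(j < k) alpha i (val b j : nat))%N.

Definition wvec (w : seq nat) (i : nat) : nat := nth 0%N w i.

Definition degw (w : seq nat) : nat := (\sum_(i < size w) 2 ^ i * nth 0%N w i)%N.

(* left-lexicographic order on weight vectors, comparing the first L entries
   (all later entries vanish for the vectors of degree < 2^L considered). *)
Definition wlt (L : nat) (u v : nat -> nat) : bool :=
  [exists i : 'I_L, [forall j : 'I_L, (j < i)%N ==> (u j == v j)] && (u i < v i)%N].
Definition wle (L : nat) (u v : nat -> nat) : bool :=
  wlt L u v || [forall i : 'I_L, u i == v i].

(* Sq^i(x^a), i = d - deg a > 0, projected into degree d via the Cartan formula: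
   coefficient of x^b is prod_j binom(a_j, b_j - a_j) (0 unless a_j <= b_j). *)
Definition Sqmon k d (a : Expo k d) : Pd k d :=
  [ffun b : Mon k d =>
     \prod_(j < k) (((a j <= val b j)%N && odd 'C(a j, (val b j - a j)%N))%:R : ('F_2)^o)].

Definition hitd k d : {vspace Pd k d} :=
  <<[seq Sqmon a | a <- enum (Expo k d) & (edeg a < d)%N]>>%VS.

Definition posmon k d (b : Mon k d) : bool := [forall j, 0 < (val b j : nat)]%N.

Definition Pplus k d : {vspace Pd k d} :=
  <<[seq mono b | b <- enum (Mon k d) & posmon b]>>%VS.

Definition Pw k (w : seq nat) : {vspace Pd k (degw w)} :=
  <<[seq mono b | b <- enum (Mon k (degw w)) & wle (degw w).+1 (wt b) (wvec w)]>>%VS.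
Definition Pwminus k (w : seq nat) : {vspace Pd k (degw w)} :=
  <<[seq mono b | b <- enum (Mon k (degw w)) & wlt (degw w).+1 (wt b) (wvec w)]>>%VS.

(* dim QP_k^+(omega) = dim (P^+ ∩ P(w)) - dim ((A^+P ∩ P^+ ∩ P(w)) + (P^+ ∩ P^-(w))),
   the denominator being a subspace of the numerator. *)
Definition dimQPplus (k : nat) (w : seq nat) : nat :=
  let d := degw w in
  (\dim (Pplus k d :&: Pw k w)
   - \dim ((hitd k d :&: Pplus k d :&: Pw k w) + (Pplus k d :&: Pwminus k w)))%N.

(* Main.v *)
(* Every element of A^+ P_5 of degree 24 is a sum of vectors [Sqmon a], that is of Steenrod squares of single
   monomials.  Restrict these to the positive monomials of the four weights
   (4,4,3) > (4,4,1,1) > (4,2,4) > (4,2,2,1), which exceed all other weights of positive monomials of degree 24,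
   and put them in echelon form for a monomial order refining the weight order.  Back-substitution writes every
   such monomial as a sum of pivot-free ("admissible") monomials of at most the same weight, modulo hit elements
   and smaller weights.  These normal forms extend to a linear map; since it vanishes on every [Sqmon a], the
   admissible monomials are independent modulo hits, and dim QP_5^+(w) is the number of those of weight w. *)
From Stdlib Require Import FMapPositive.
From HB Require Import structures.
From mathcomp Require Import all_boot all_order all_algebra.
Require Import Defs.
Set Implicit Arguments. Unset Strict Implicit. Unset Printing Implicit Defensive.
Import GRing.Theory.

Module PM := PositiveMap.

(** * The elimination *)

(* [nth [::] posts x] lists the exponents [y > 0] such that [Sq^(y-x)] maps [X^x] to [X^y]. *)
Definition posts : seq (seq nat) := Eval vm_compute in
  [seq [seq y <- iota 1 24 | (x <= y) && odd 'C(x, y - x)] | x <- iota 0 25].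

Definition bits : seq (seq nat) := Eval vm_compute in
  [seq [seq alpha i x | i <- iota 0 5] | x <- iota 0 25].

Fixpoint sqterms (a : seq nat) (n : nat) : seq (seq nat) :=
  match a with
  | [::] => match n with 0 => [:: [::]] | _ => [::] end
  | x :: a' =>
    [seq y :: b | y <- nth [::] posts x, b <- if Nat.leb y n then sqterms a' (n - y) else [::]]
  end.

Fixpoint comps (k n : nat) : seq (seq nat) :=
  match k with
  | 0 => match n with 0 => [:: [::]] | _ => [::] end
  | k'.+1 =>
    [seq y :: b | y <- iota 1 24, b <- if Nat.leb y n then comps k' (n - y) else [::]]
  end.

Fixpoint lexcmp (s t : seq nat) : comparison :=
  match s, t with
  | [::], [::] => Eq
  | [::], _ => Lt
  | _, [::] => Gt
  | x :: s', y :: t' => match Nat.compare x y with Eq => lexcmp s' t' | c => c end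
  end.

Definition eql s t := if lexcmp s t is Eq then true else false.

Definition ltl s t := if lexcmp s t is Lt then true else false.

Fixpoint addl (s t : seq nat) : seq nat :=
  match s, t with
  | x :: s', y :: t' => Nat.add x y :: addl s' t'
  | _, _ => [::]
  end.

Definition wtl (b : seq nat) : seq nat :=
  foldr (fun x w => addl (nth [::] bits x) w) (nseq 5 0) b.

(* In decreasing order; a positive monomial in none of these classes has a smaller weight (see [cls_rank]). *)
Definition ws : seq (seq nat) :=
  [:: [:: 4; 4; 3; 0; 0]; [:: 4; 4; 1; 1; 0]; [:: 4; 2; 4; 0; 0]; [:: 4; 2; 2; 1; 0]].

Definition cls (b : seq nat) : nat := let w := wtl b in find (eql w) ws.

(* Prefixing the class makes the lexicographic order of labels refine the decreasing weight order. *)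
Definition label (b : seq nat) : seq nat := cls b :: b.

(** Addition over F_2 of vectors given by their sorted supports: equal heads cancel. The inner [fix]
    is there because either argument may be the one that decreases. *)
Fixpoint xmerge (s : seq (seq nat)) : seq (seq nat) -> seq (seq nat) :=
  fix aux t := match s, t with
  | [::], _ => t
  | _, [::] => s
  | x :: s', y :: t' =>
    match lexcmp x y with
    | Eq => xmerge s' t'
    | Lt => x :: xmerge s' t
    | Gt => y :: aux t'
    end
  end.

Definition xsum : seq (seq (seq nat)) -> seq (seq nat) := foldr xmerge [::].

(* A prefix code, hence injective. *)
Fixpoint enc (l : seq nat) : BinNums.positive :=
  match l with
  | [::] => BinNums.xH
  | x :: l' => iter x BinNums.xI (BinNums.xO (enc l'))
  end.

(** [xsum] on singletons is an insertion sort; it puts a monomial of largest weight, that is of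
    least label, at the head, where [insert_row] looks for the pivot. *)
Definition row (a : seq nat) : seq (seq nat) :=
  xsum [seq [:: l] | l <- [seq label b | b <- sqterms a 24] & Nat.ltb (head 0 l) 4].

(* The four weights start with 4 and [y] odd in [posts x] forces [x] odd, so fewer than four odd exponents
   in [a] give an empty row. *)
Definition rows : seq (seq (seq nat)) :=
  [seq row a | a <- flatten [seq [seq a <- comps 5 n | Nat.leb 4 (count odd a)]
                            | n <- rev (iota 0 24)]].

Definition labels : seq (seq nat) :=
  [seq l <- [seq label b | b <- comps 5 24] | Nat.ltb (head 0 l) 4].

(* A rule [l |-> t] stands for the congruence of the monomial [l] with the sum of the monomials in [t]. *)
Definition rules := PM.t (seq (seq nat)).

(* Running out of fuel would only drop a row, which is sound; [check] would then fail. *)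
Fixpoint insert_row (fuel : nat) (m : rules) (r : seq (seq nat)) : rules :=
  match fuel, r with
  | fuel'.+1, h :: t =>
    match PM.find (enc h) m with
    | Some t' => insert_row fuel' m (xmerge t t')
    | None => PM.add (enc h) t m
    end
  | _, _ => m
  end.

Definition gauss (rs : seq (seq (seq nat))) : rules :=
  foldl (insert_row 300) (PM.empty _) rs.

Definition reduce (m : rules) (l : seq nat) : seq (seq nat) :=
  if PM.find (enc l) m is Some v then v else [:: l].

Definition is_free (m : rules) (l : seq nat) : bool :=
  if PM.find (enc l) m is Some _ then false else true.

(** The terms of a tail have larger labels than its pivot. When [ls] is in decreasing order their
    final rules are already in [m], so a single substitution gives a pivot-free normal form. *)
Definition backsub (m0 : rules) (ls : seq (seq nat)) : rules :=
  foldl (fun m l =>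
           if PM.find (enc l) m0 is Some t
           then PM.add (enc l) (xsum [seq reduce m x | x <- t]) m else m)
        (PM.empty _) ls.

(** [comps] enumerates lexicographically upwards, so reversing inside each class and taking the
    classes from 3 down to 0 sorts [labels] in decreasing order. *)
Definition descending (ls : seq (seq nat)) : seq (seq nat) :=
  flatten [seq rev [seq l <- ls | Nat.eqb (head 0 l) r] | r <- rev (iota 0 4)].

(** A certificate on the final rules: all rows reduce to zero (for [nf_Sqmon]), normal forms consist
    of admissible positive monomials of no larger weight (for [nf_mspan]), and the admissible
    monomials are counted in the order of [ws] (for [card_free]). *)
Definition check_reduced (ls : seq (seq nat)) (rs : seq (seq (seq nat))) (m : rules) : bool :=
  [&& all (fun r => nilp (xsum [seq reduce m l | l <- r])) rs,
      all (fun l => all (fun x =>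
        [&& Nat.leb (head 0 l) (head 0 x), Nat.ltb (head 0 x) 4, is_free m x,
            eql x (label (behead x)) & all (Nat.ltb 0) (behead x)]) (reduce m l)) ls
    & eql [seq count (fun l => Nat.eqb (head 0 l) r && is_free m l) ls | r <- iota 0 4]
          [:: 75; 145; 1; 390]].

Definition normal_forms (ls : seq (seq nat)) (rs : seq (seq (seq nat))) : rules :=
  backsub (gauss rs) (descending ls).

Definition check (ls : seq (seq nat)) (rs : seq (seq (seq nat))) : bool :=
  let m := normal_forms ls rs in check_reduced ls rs m.

Lemma check_true : check labels rows.
Proof. by vm_compute. Qed.

Lemma cls_rank :
  all (fun b => all (fun i => (ltl (wtl b) (nth [::] ws i) == (i < cls b)) &&
                              (eql (wtl b) (nth [::] ws i) == (cls b == i))) (iota 0 4))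
      (comps 5 24).
Proof. by vm_compute. Qed.

Local Open Scope ring_scope.

(** * Spans of monomials *)

Section MonomialSpans.
Variables (k d : nat).
Implicit Types (x y : Pd k d) (b c : Mon k d) (p q : pred (Mon k d)).

Lemma addPP x : x + x = 0.
Proof. by apply/ffunP=> b; rewrite !ffunE -mulr2n -mulr_natr pchar_Zp // mulr0. Qed.

Lemma Pd_expand x : x = \sum_b x b *: mono b.
Proof.
apply/ffunP=> c; rewrite sum_ffunE (bigD1 c) //= big1 => [|b /negPf nbc].
  by rewrite !ffunE eqxx /= addr0 /GRing.scale /= mulr1.
by rewrite !ffunE eq_sym nbc scaler0.
Qed.

Definition mspan p : {vspace Pd k d} :=
  <<[seq mono b | b <- enum (Mon k d) & p b]>>%VS.

Lemma mem_mono_mspan p b : p b -> mono b \in mspan p.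
Proof.
by move=> pb; apply/memv_span/mapP; exists b; rewrite // mem_filter pb mem_enum.
Qed.

Lemma mspanP p x : reflect (forall b, ~~ p b -> x b = 0) (x \in mspan p).
Proof.
apply: (iffP idP) => [xp b npb | x0].
  rewrite (coord_span (X := in_tuple _) xp) sum_ffunE big1 // => i _; rewrite ffunE.
  have /mapP[c] := mem_nth 0 (ltn_ord i); rewrite mem_filter => /andP[pc _] /= ->.
  rewrite ffunE.
  by case: eqP npb => [->|_ _]; rewrite ?pc // scaler0.
rewrite (Pd_expand x) memv_suml // => b _.
case pb: (p b); first by rewrite memvZ ?mem_mono_mspan.
by rewrite x0 ?pb // scale0r mem0v.
Qed.

Lemma mspanS p q : (forall b, p b -> q b) -> (mspan p <= mspan q)%VS.
Proof.
move=> pq; apply/subvP=> x /mspanP xp; apply/mspanP=> b nqb.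
by apply: xp; apply: contra nqb => /pq.
Qed.

Lemma eq_mspan p q : p =1 q -> mspan p = mspan q.
Proof. by move=> pq; rewrite /mspan (eq_filter pq). Qed.

Lemma mspanI p q : (mspan p :&: mspan q)%VS = mspan (predI p q).
Proof.
apply/vspaceP=> x; rewrite memv_cap; apply/andP/mspanP => [[/mspanP xp /mspanP xq] b|xpq].
  by rewrite negb_and => /orP[/xp|/xq].
by split; apply/mspanP=> b npb; apply: xpq; rewrite negb_and npb ?orbT.
Qed.

Lemma dim_mspan p : \dim (mspan p) = #|p|.
Proof.
rewrite /mspan; set s := filter _ _; have us : uniq s by rewrite filter_uniq ?enum_uniq.
suff fs : free (map (@mono k d) s).
  rewrite (eqnP fs) size_map -(card_uniqP us); apply: eq_card => b.
  by rewrite mem_filter mem_enum andbT.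
elim: s us => [|b s IHs] /=; first by rewrite nil_free.
case/andP=> nbs us; rewrite free_cons IHs // andbT.
(* Elements of the span of the other monomials have coefficient 0 at [b], while [mono b] has
   coefficient 1 there. *)
apply: contra nbs => bs; apply: contraT => nbs.
have : mono b \in mspan (mem s).
  by apply: subvP bs; apply/span_subvP=> _ /mapP[c cs ->]; apply: mem_mono_mspan.
by move/mspanP/(_ b nbs)/eqP; rewrite ffunE eqxx oner_eq0.
Qed.

Definition mext (nf : Mon k d -> Pd k d) x : Pd k d := \sum_b x b *: nf b.

Lemma mext_is_linear nf : linear (mext nf).
Proof.
move=> a x y; rewrite /mext scaler_sumr -big_split; apply: eq_bigr => b _ /=.
by rewrite !ffunE scalerDl scalerA.
Qed.
HB.instance Definition _ nf :=
  GRing.isLinear.Build _ (Pd k d) (Pd k d) _ (mext nf) (mext_is_linear nf).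

Lemma mext_mono nf b : mext nf (mono b) = nf b.
Proof.
rewrite /mext (bigD1 b) //= big1 => [|c /negPf ncb]; rewrite ffunE.
  by rewrite eqxx scale1r addr0.
by rewrite ncb scale0r.
Qed.

End MonomialSpans.

(* [nf b] is a normal form of [mono b] modulo [H] and the classes [>= n] (in characteristic 2, [+] is [-]).
   Keeping only the class-[i] part of normal forms is a linear map on the span of the classes [>= i] whose
   kernel is the denominator and whose image is the span of the admissible monomials of class [i]. *)
Lemma dim_normal_form (k d n i : nat) (H : {vspace Pd k d}) (pos adm : pred (Mon k d))
    (cl : Mon k d -> nat) (nf : Mon k d -> Pd k d)
    (ge := fun j => mspan (fun b => pos b && (j <= cl b)%N)) :
  (i < n)%N ->
  (forall b, pos b -> mono b + nf b \in (H :&: mspan pos + ge n)%VS) ->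
  (forall x, x \in H -> mext nf x = 0) ->
  (forall b, pos b -> nf b \in mspan (fun c => [&& pos c, adm c & (cl b <= cl c < n)%N])) ->
  (forall b, pos b -> (cl b < n)%N -> adm b -> nf b = mono b) ->
  (\dim (ge i) - \dim (H :&: ge i + ge i.+1)%VS = #|[pred b | [&& pos b, adm b & cl b == i]]|)%N.
Proof.
move=> lt_in nf_rel nf_H nf_tri nf_adm.
pose proj (x : Pd k d) : Pd k d := [ffun c => if cl c == i then x c else 0].
pose g := linfun (mext (fun b => proj (nf b))).
have gE x : g x = proj (mext nf x).
  rewrite lfunE /= /mext; apply/ffunP=> c; rewrite !ffunE !sum_ffunE.
  case: ifP => ci; last by rewrite big1 // => b _; rewrite !ffunE ci scaler0.
  by apply: eq_bigr => b _; rewrite !ffunE ci.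
have geS j1 j2 : (j1 <= j2)%N -> (ge j2 <= ge j1)%VS.
  by move=> j12; apply: mspanS => b /andP[-> /(leq_trans j12)].
have f_ge j x : x \in ge j ->
    mext nf x \in mspan (fun c => [&& pos c, adm c & (j <= cl c < n)%N]).
  move=> /mspanP xj; apply: memv_suml => b _.
  case: (boolP (pos b && (j <= cl b)%N)) => [/andP[pb jb]|/xj->]; last first.
    by rewrite scale0r mem0v.
  apply/memvZ/(subvP _ _ (nf_tri b pb))/mspanS => c /and4P[-> -> jc ->].
  by rewrite (leq_trans jb jc).
have kerE : (ge i :&: lker g)%VS = (H :&: ge i + ge i.+1)%VS.
  apply/vspaceP=> x; rewrite memv_cap memv_ker gE; apply/andP/idP => [[xi /eqP gx0]|].
    (* [g x = 0] removes the class-[i] part of the normal form of [x], which leaves only classes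
       above [i]. *)
    have fx : mext nf x \in ge i.+1.
      apply/mspanP=> c; rewrite negb_and => npc.
      have /mspanP/(_ c) := f_ge i x xi; rewrite !negb_and.
      case: (ltngtP i (cl c)) npc => [lt_ic|lt_ci|eq_ic] npc f0.
      - by rewrite orbF in npc; rewrite f0 // npc.
      - by rewrite f0 // !orbT.
      by move/ffunP/(_ c): gx0; rewrite !ffunE eq_ic eqxx.
    have : x + mext nf x \in (H :&: mspan pos + ge n)%VS.
      rewrite {1}(Pd_expand x) -big_split; apply: memv_suml => b _ /=; rewrite -scalerDr.
      case: (boolP (pos b)) => [pb|npb]; first by rewrite memvZ ?nf_rel.
      by move/mspanP: xi => -> //; rewrite ?(negPf npb) // scale0r mem0v.
    case/memv_addP=> h hH [y yn xfE].
    have yi1 : y \in ge i.+1 by apply: subvP yn; apply: geS.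
    (* The bracket lies in [ge i.+1]. The hit part [h] lies in [ge i] because it is the sum of [x],
       its normal form and [y], which all do. *)
    have -> : x = h + (y + mext nf x) by rewrite addrA -xfE -addrA addPP addr0.
    apply: memv_add; last by rewrite memvD.
    move: hH; rewrite !memv_cap => /andP[-> _] /=.
    have -> : h = x + mext nf x + y by rewrite xfE -addrA addPP addr0.
    by rewrite !memvD // (subvP (geS i i.+1 _)).
  (* Conversely, [h] is hit and has normal form 0, and the normal form of [y] has no term of class
     [i]. *)
  case/memv_addP=> h; rewrite memv_cap => /andP[hH hi] [y yi1 ->].
  split; first by rewrite memvD // (subvP (geS i i.+1 _)).
  rewrite raddfD /= nf_H // add0r; apply/eqP/ffunP=> c; rewrite !ffunE.
  case: eqP => // ci; move/mspanP: (f_ge _ _ yi1); apply.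
  by rewrite ci ltnn !andbF.
have imgE : (g @: ge i)%VS = mspan [pred b | [&& pos b, adm b & cl b == i]].
  apply/eqP; rewrite eqEsubv; apply/andP; split.
    apply/subvP=> _ /memv_imgP[x xi ->]; rewrite gE; apply/mspanP=> c npc; rewrite ffunE.
    case: eqP npc => //= ci npc; have /mspanP := f_ge _ _ xi; apply.
    by apply: contra npc => /and3P[-> -> _]; rewrite ci eqxx.
  apply/span_subvP=> x /mapP[b]; rewrite mem_filter => /andP[/and3P[pb ab /eqP bi] _] ->{x}.
  have bn : (cl b < n)%N by rewrite bi.
  have -> : mono b = g (mono b).
    rewrite gE mext_mono nf_adm //; apply/ffunP=> c; rewrite !ffunE.
    by case: (eqVneq c b) => [->|]; rewrite ?bi ?eqxx ?if_same.
  by rewrite memv_img // mem_mono_mspan // pb bi leqnn.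
by rewrite -kerE -(limg_ker_dim g (ge i)) addKn imgE dim_mspan.
Qed.

(** * Soundness of the elimination *)

Lemma lexcmp_eq s t : lexcmp s t = Eq -> s = t.
Proof.
elim: s t => [|x s IHs] [|y t] //=; case E: (Nat.compare x y) => // st.
by rewrite (IHs _ st) (PeanoNat.Nat.compare_eq _ _ E).
Qed.

Lemma eqlP s t : eql s t -> s = t.
Proof. by rewrite /eql; case E: lexcmp => // _; apply: lexcmp_eq. Qed.

Lemma lexcmp_refl s : lexcmp s s = Eq.
Proof. by elim: s => //= x s ->; rewrite PeanoNat.Nat.compare_refl. Qed.

Lemma eqlE s t : eql s t = (s == t).
Proof. by apply/idP/eqP => [/eqlP|->] //; rewrite /eql lexcmp_refl. Qed.

Lemma enc_inj : injective enc.
Proof.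
elim=> [|x s IHs] [|y t] //=; [by case: y|by case: x|].
elim: x y => [|x IHx] [|y] //= => [[/IHs->] //|[/IHx[-> ->]]] //.
Qed.

Lemma find_add (m : rules) l l' t :
  PM.find (enc l) (PM.add (enc l') t m) = if l == l' then Some t else PM.find (enc l) m.
Proof.
case: eqP => [->|ne]; first exact: PM.gss.
by apply: PM.gso => /enc_inj.
Qed.

Section Reduction.
Variables (F : fieldType) (V : vectType F) (addVV : forall x : V, x + x = 0).
Variables (f : seq nat -> V) (Z : {vspace V}).

Let fsum s := \sum_(l <- s) f l.

Lemma sum_xmerge s t : fsum (xmerge s t) = fsum s + fsum t.
Proof.
rewrite /fsum; elim: s t => [|x s IHs]; first by case=> *; rewrite big_nil add0r.
elim=> [|y t IHt] /=; first by rewrite big_nil addr0.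
case E: lexcmp; rewrite !big_cons.
- by rewrite (lexcmp_eq E) IHs addrACA addVV add0r.
- by rewrite IHs big_cons addrA.
by rewrite IHt big_cons addrCA.
Qed.

Lemma sum_xsum ss : fsum (xsum ss) = \sum_(s <- ss) fsum s.
Proof.
elim: ss => [|s ss IHss] /=; first by rewrite /fsum !big_nil.
by rewrite sum_xmerge IHss big_cons.
Qed.

Definition sound (m : rules) :=
  forall l t, PM.find (enc l) m = Some t -> f l + fsum t \in Z.

Lemma sound_empty : sound (PM.empty _).
Proof. by move=> l t; rewrite PM.gempty. Qed.

Lemma sound_add m l t : sound m -> f l + fsum t \in Z -> sound (PM.add (enc l) t m).
Proof.
by move=> sm lt l' t'; rewrite find_add; case: eqP => [-> [<-]|_ /sm].
Qed.

Lemma sound_insert_row fuel m r : sound m -> fsum r \in Z -> sound (insert_row fuel m r).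
Proof.
elim: fuel m r => [|n IHn] m [|h t] //= sm rZ.
case E: PM.find => [t'|]; last by apply: sound_add => //; rewrite /fsum big_cons in rZ.
apply: IHn => //; rewrite sum_xmerge.
(* The pivot [h] occurs both in the row and in the stored rule, so it cancels. *)
have -> : fsum t + fsum t' = fsum (h :: t) + (f h + fsum t').
  by rewrite /fsum big_cons addrACA addVV add0r.
by rewrite memvD // sm.
Qed.

Lemma sound_gauss rs : {in rs, forall r, fsum r \in Z} -> sound (gauss rs).
Proof.
rewrite /gauss; move: (PM.empty _) sound_empty.
elim: rs => [//|r rs IHrs] m sm rsZ; apply: (IHrs (insert_row 300 m r)) => [|r' r'rs].
  by apply: sound_insert_row sm (rsZ _ (mem_head _ _)).
by apply: rsZ; rewrite inE r'rs orbT.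
Qed.

Lemma sound_reduce m l : sound m -> f l + fsum (reduce m l) \in Z.
Proof.
move=> sm; rewrite /reduce; case E: PM.find => [t|]; first exact: sm.
by rewrite /fsum big_seq1 addVV mem0v.
Qed.

Lemma sound_backsub m0 ls : sound m0 -> sound (backsub m0 ls).
Proof.
move=> sm0; rewrite /backsub; move: (PM.empty _) sound_empty.
elim: ls => [|l ls IHls] m sm //=; apply: IHls.
case E: PM.find => [t|] //; apply: sound_add => //.
rewrite sum_xsum big_map.
(* The sum over the old tail [t] is inserted twice: once to use the old rule for [l], once to pair
   each [x] with its reduction. *)
have -> : f l + \sum_(x <- t) fsum (reduce m x) =
    f l + fsum t + \sum_(x <- t) (f x + fsum (reduce m x)).
  by rewrite big_split /= -/(fsum t) -addrA [fsum t + _]addrA addVV add0r.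
by rewrite memvD ?sm0 // memv_suml // => x _; apply: sound_reduce.
Qed.

End Reduction.

(** * Exponent lists and the vectors [Sqmon a] *)

Lemma lebE m n : Nat.leb m n = (m <= n)%N.
Proof. by elim: m n => [|m IHm] [|n] //; apply: IHm. Qed.

Lemma ltbE m n : Nat.ltb m n = (m < n)%N.
Proof. exact: lebE. Qed.

Lemma eqbE m n : Nat.eqb m n = (m == n)%N.
Proof. by elim: m n => [|m IHm] [|n] //; apply: IHm. Qed.

Local Notation in_range := (all (fun x => 0 < x <= 24)%N).

Lemma mem_iota24 y : (y \in iota 1 24) = (0 < y <= 24)%N.
Proof. by rewrite mem_iota. Qed.

Lemma mem_comps k n b :
  (b \in comps k n) = [&& size b == k, in_range b & sumn b == n].
Proof.
elim: k n b => [|k IHk] n b.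
  by case: b => [|x b]; case: n.
apply/allpairsPdep/idP => [[y [t [yr + ->]]]|].
  rewrite lebE; case: leqP => // yn; rewrite IHk; rewrite mem_iota24 in yr.
  by move=> /and3P[/eqP<- tr /eqP st]; rewrite /= yr tr st subnKC // !eqxx.
case: b => // y t /and3P[/= tk /andP[yr tr] /eqP stn]; exists y, t.
have yn : (y <= n)%N by rewrite -stn leq_addr.
by rewrite lebE yn mem_iota24 yr IHk tr -stn addKn eqxx -eqSS tk.
Qed.

Lemma comps_uniq k n : uniq (comps k n).
Proof.
elim: k n => [|k IHk] n; first by case: n.
apply: allpairs_uniq_dep => [|y _|[y1 t1] [y2 t2] _ _ /= [-> ->]] //.
by case: Nat.leb.
Qed.

Lemma posts_spec :
  posts = [seq [seq y <- iota 1 24 | (x <= y)%N && odd 'C(x, y - x)] | x <- iota 0 25].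
Proof. by vm_compute. Qed.

Lemma mem_posts x y : (x <= 24)%N ->
  (y \in nth [::] posts x) = [&& (0 < y <= 24)%N, (x <= y)%N & odd 'C(x, y - x)].
Proof.
move=> x24; rewrite posts_spec (nth_map 0%N) ?size_iota // nth_iota // mem_filter mem_iota24.
by rewrite andbC.
Qed.

Lemma mem_sqterms a n b :
  (b \in sqterms a n) = all2 (fun x y => y \in nth [::] posts x) a b && (sumn b == n).
Proof.
elim: a n b => [|x a IHa] n b; first by case: b => [|y b]; case: n.
apply/allpairsPdep/idP => [[y [t [yx + ->]]]|].
  rewrite lebE; case: leqP => // yn; rewrite IHa => /andP[ta /eqP st].
  by rewrite /= yx st subnKC // eqxx andbT; apply: ta.
case: b => // y t /andP[/andP[yx ta] /eqP stn]; exists y, t.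
have yn : (y <= n)%N by rewrite -stn leq_addr.
by rewrite yx lebE yn IHa -stn addKn eqxx andbT; split=> //; apply: ta.
Qed.

Lemma sqterms_uniq a n : uniq (sqterms a n).
Proof.
elim: a n => [|x a IHa] n; first by case: n.
apply: allpairs_uniq_dep => [|y _|[y1 t1] [y2 t2] _ _ /= [-> ->]] //; last by case: Nat.leb.
case: (ltnP x 25) => [x25|x25]; last by rewrite nth_default.
by rewrite posts_spec (nth_map 0%N) ?size_iota // filter_uniq ?iota_uniq.
Qed.

Definition lst k d (a : Expo k d) : seq nat := [seq (a j : nat) | j <- enum 'I_k].

Lemma size_lst k d (a : Expo k d) : size (lst a) = k.
Proof. by rewrite size_map size_enum_ord. Qed.

Lemma nth_lst k d (a : Expo k d) (j : 'I_k) : nth 0%N (lst a) j = a j.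
Proof. by rewrite (nth_map j) ?size_enum_ord // nth_ord_enum. Qed.

Lemma sumn_lst k d (a : Expo k d) : sumn (lst a) = edeg a.
Proof. by rewrite sumnE big_map enumT. Qed.

Lemma lst_inj k d : injective (@lst k d).
Proof. by move=> a b ab; apply/ffunP=> j; apply: val_inj; rewrite /= -!nth_lst ab. Qed.

Lemma all_lst k d (p : pred nat) (a : Expo k d) : all p (lst a) = [forall j, p (a j)].
Proof.
rewrite all_map; apply/allP/forallP => [pa j|pa j _]; last exact: pa.
by apply: pa; rewrite mem_enum.
Qed.

Lemma lst_surj k d (l : seq nat) :
  size l = k -> all (leq^~ d) l -> exists a : Expo k d, lst a = l.
Proof.
move=> sl ld; exists [ffun j : 'I_k => inord (nth 0%N l j)].
apply: (@eq_from_nth _ 0%N) => [|i]; rewrite size_lst ?sl // => ik.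
rewrite (nth_lst _ (Ordinal ik)) ffunE inordK // ltnS.
by apply: (allP ld); rewrite mem_nth ?sl.
Qed.

Local Notation M := (Mon 5 24).
Local Notation mlst c := (lst (val c)).

Lemma mlst_inj : injective (fun c : M => mlst c).
Proof. by move=> b c /lst_inj/val_inj. Qed.

Lemma in_range_lst (c : M) : in_range (mlst c) = posmon c.
Proof. by rewrite all_lst; apply: eq_forallb => j; rewrite -[(_ <= 24)%N]ltnS ltn_ord andbT. Qed.

Lemma mlst_comps (c : M) : (mlst c \in comps 5 24) = posmon c.
Proof. by rewrite mem_comps size_lst in_range_lst sumn_lst (valP c) andbT. Qed.

Lemma mlst_surj l : l \in comps 5 24 -> exists c : M, mlst c = l.
Proof.
rewrite mem_comps => /and3P[/eqP sl lr /eqP l24].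
have [|a al] := @lst_surj 5 24 l sl; first by apply: sub_all lr => x /andP[].
have aM : edeg a == 24%N by rewrite -sumn_lst al l24.
by exists (exist _ a aM).
Qed.

(** Carries sums and counts over the lists used in the computation to the finite type of
    monomials. *)
Lemma perm_mlst (l : seq (seq nat)) : uniq l -> {subset l <= comps 5 24} ->
  perm_eq [seq mlst c | c <- enum M & mlst c \in l] l.
Proof.
move=> ul lP; apply: uniq_perm => //.
  by rewrite (map_inj_uniq mlst_inj) filter_uniq ?enum_uniq.
move=> b; apply/mapP/idP => [[c]|bl].
  by rewrite mem_filter => /andP[cl _] ->.
have [c cb] := mlst_surj (lP b bl).
by exists c; rewrite // mem_filter cb bl mem_enum.
Qed.

Lemma card_posmon (q : pred (seq nat)) :
  #|[pred c : M | posmon c && q (mlst c)]| = count q (comps 5 24).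
Proof.
have := perm_mlst (filter_uniq q (comps_uniq 5 24)) (mem_subseq (filter_subseq q _)).
move/perm_size; rewrite size_filter => <-; rewrite size_map -(card_uniqP _).
  by apply: eq_card => c; rewrite mem_filter mem_enum mem_filter mlst_comps andbT andbC.
by rewrite filter_uniq ?enum_uniq.
Qed.

(** An exponent 0 cannot become positive, since C(0, y) = 0 for y > 0; beyond 24 the table [posts]
    returns the empty list. *)
Lemma sqterms_range a b : b \in sqterms a 24 -> all (fun x => 0 < x)%N a /\ in_range b.
Proof.
rewrite mem_sqterms => /andP[+ _].
elim: a b => [|x a IHa] [|y b] //= /andP[yx /IHa[-> ->]]; rewrite !andbT.
case: (leqP x 24) => x24; last by rewrite nth_default in yx.
move: yx; rewrite mem_posts // => /and3P[yr xy]; rewrite yr; case: x {x24} xy => // _.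
by rewrite subn0 bin0n; case: y yr.
Qed.

Lemma sqterms_comps a b : size a = 5%N -> b \in sqterms a 24 -> b \in comps 5 24.
Proof.
move=> sa ba; have [_ rb] := sqterms_range ba; rewrite mem_comps rb /=.
move: ba; rewrite mem_sqterms all2E sa => /andP[/andP[/eqP<- _] ->].
by rewrite eqxx.
Qed.

Lemma Sqmon_coef (a : Expo 5 24) (c : M) : posmon c ->
  Sqmon a c = (mlst c \in sqterms (lst a) 24)%:R.
Proof.
move=> pc; rewrite ffunE mem_sqterms sumn_lst (valP c) andbT.
rewrite all2E !size_lst eqxx /=.
have -> : zip (lst a) (mlst c) = [seq (a j : nat, val c j : nat) | j <- enum 'I_5].
  by rewrite /lst zip_map.
rewrite all_map -big_enum /=; elim: (enum 'I_5) => [|j s IHs]; first by rewrite big_nil.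
rewrite big_cons IHs /= mem_posts; last by rewrite -ltnS ltn_ord.
move/forallP: pc => ->; rewrite -[(_ <= 24)%N]ltnS ltn_ord /=.
by case: (_ && _); rewrite ?mul1r ?mul0r.
Qed.

(* Zero when [l] is not the exponent list of a monomial. *)
Definition smono (l : seq nat) : Pd 5 24 := [ffun c : M => (mlst c == l)%:R].

Lemma smono_mlst (c : M) : smono (mlst c) = mono c.
Proof. by apply/ffunP=> c'; rewrite !ffunE (inj_eq mlst_inj). Qed.

Lemma mem_smono (p : pred M) l : (forall c, mlst c = l -> p c) -> smono l \in mspan p.
Proof.
by move=> lp; apply/mspanP=> c npc; rewrite ffunE; case: eqP => // /lp pc; rewrite pc in npc.
Qed.

(** Squares never lower an exponent, so for positive [a] every monomial of [Sqmon a] is positive,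
    and [sqterms], which lists positive targets only, misses none. *)
Lemma Sqmon_smono (a : Expo 5 24) : all (fun x => 0 < x)%N (lst a) ->
  Sqmon a = \sum_(l <- sqterms (lst a) 24) smono l.
Proof.
move=> a_gt0; apply/ffunP=> c; rewrite sum_ffunE.
under eq_bigr do rewrite ffunE.
have -> : \sum_(l <- sqterms (lst a) 24) ((mlst c == l)%:R : 'F_2) =
          (mlst c \in sqterms (lst a) 24)%:R.
  elim: (sqterms _ _) (sqterms_uniq (lst a) 24) => [|l s IHs] /=; first by rewrite big_nil.
  case/andP=> ls us; rewrite big_cons IHs // inE.
  by case: eqP => [->|_]; rewrite ?(negPf ls) ?addr0 ?add0r.
case: (boolP (posmon c)) => [/Sqmon_coef//|npc].
rewrite [_ \in _]negbTE; last first.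
  by apply: contra npc => /sqterms_range[_]; rewrite in_range_lst.
have [j] := forallPn npc; rewrite -eqn0Ngt => /eqP cj0.
rewrite ffunE (bigD1 j) //= cj0; move: a_gt0; rewrite all_lst => /forallP/(_ j).
by case: (nat_of_ord (a j)) => // n _; rewrite mul0r.
Qed.

Lemma sum_sqterms (V : nmodType) (a : Expo 5 24) (f : seq nat -> V) :
  \sum_(l <- sqterms (lst a) 24) f l = \sum_(c : M | mlst c \in sqterms (lst a) 24) f (mlst c).
Proof.
have sP : {subset sqterms (lst a) 24 <= comps 5 24}.
  by move=> l; apply: sqterms_comps; rewrite size_lst.
rewrite -(perm_big _ (perm_mlst (sqterms_uniq _ _) sP)) big_map big_filter.
by rewrite big_enum_cond.
Qed.

(** * Weights *)

Lemma mkseqSl (T : Type) (u : nat -> T) n :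
  mkseq u n.+1 = u 0%N :: mkseq (fun i => u i.+1) n.
Proof. by rewrite /mkseq /= (iotaDl 1 0) -map_comp. Qed.

Lemma ltl_cons x y s t : ltl (x :: s) (y :: t) = (x < y)%N || (x == y) && ltl s t.
Proof.
rewrite /ltl /= -eqbE -ltbE.
case: PeanoNat.Nat.compare_spec => [->|lt_xy|lt_yx].
- by rewrite PeanoNat.Nat.ltb_irrefl PeanoNat.Nat.eqb_refl.
- by move/PeanoNat.Nat.ltb_lt: lt_xy => ->.
rewrite ltbE eqbE; move/PeanoNat.Nat.ltb_lt: lt_yx; rewrite ltbE.
by case: ltngtP.
Qed.

(** Splitting off the first entry gives the recursion that [ltl] satisfies on lists. *)
Lemma wltS L u v : wlt L.+1 u v =
  (u 0 < v 0)%N || (u 0 == v 0)%N && wlt L (fun i => u i.+1) (fun i => v i.+1).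
Proof.
apply/existsP/orP => [[i /andP[/forallP eq_lt lt_i]]|[lt0|/andP[eq0 /existsP[i]]]].
- case: (unliftP ord0 i) => [i'|] ii'; last by left; rewrite ii' in lt_i.
  right; apply/andP; split; first by have := eq_lt ord0; rewrite ii'.
  apply/existsP; exists i'; rewrite {2}ii' lift0 in lt_i; rewrite -[i'.+1]lift0 -ii'.
  rewrite ii' lift0 in lt_i *; rewrite lt_i andbT; apply/forallP=> j.
  by have := eq_lt (lift ord0 j); rewrite ii' !lift0.
- by exists ord0; rewrite lt0 andbT; apply/forallP.
case/andP=> /forallP eq_lt lt_i; exists (lift ord0 i); rewrite lift0 lt_i andbT.
apply/forallP=> j; case: (unliftP ord0 j) => [j'|] ->; last by rewrite eq0 implybT.
by rewrite !lift0; apply: eq_lt.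
Qed.

Lemma wlt_ltl n L u v : (n <= L)%N -> (forall i, (n <= i)%N -> u i = v i) ->
  wlt L u v = ltl (mkseq u n) (mkseq v n).
Proof.
elim: n L u v => [|n IHn] L u v nL uv.
  by apply/existsP=> -[i /andP[_]]; rewrite uv // ltnn.
case: L nL => // L nL; rewrite wltS !mkseqSl ltl_cons (IHn L) // => i ni.
exact: uv.
Qed.

Lemma weq_eql n L (u v : nat -> nat) : (n <= L)%N -> (forall i, (n <= i)%N -> u i = v i) ->
  [forall i : 'I_L, u i == v i] = eql (mkseq u n) (mkseq v n).
Proof.
move=> nL uv; rewrite eqlE; apply/forallP/eqP => [uvL|uvn i].
  apply/eq_in_map=> i; rewrite mem_iota add0n => /= lt_in.
  exact/eqP/(uvL (Ordinal (leq_trans lt_in nL))).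
case: (ltnP i n) => [lt_in|/uv->] //.
by rewrite -(nth_mkseq 0%N u lt_in) uvn nth_mkseq.
Qed.

Lemma bits_spec : bits = [seq mkseq (alpha^~ x) 5 | x <- iota 0 25].
Proof. by vm_compute. Qed.

Lemma wtl_alpha b : in_range b -> wtl b = mkseq (fun i => sumn [seq alpha i x | x <- b]) 5.
Proof.
elim: b => [|x b IHb] //= /andP[/andP[_ x24] rb]; rewrite IHb //.
by rewrite bits_spec (nth_map 0%N) ?size_iota // nth_iota.
Qed.

Lemma wt_sumn (c : M) i : wt c i = sumn [seq alpha i x | x <- mlst c].
Proof. by rewrite sumnE 2!big_map enumT. Qed.

Lemma alpha_small i x : (5 <= i)%N -> (x <= 24)%N -> alpha i x = 0%N.
Proof.
move=> i5 x24; rewrite /alpha divn_small //.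
by apply: leq_ltn_trans x24 (leq_trans _ (leq_pexp2l _ i5)).
Qed.

Lemma wt_wtl (c : M) : posmon c -> wtl (mlst c) = mkseq (wt c) 5.
Proof.
by rewrite -in_range_lst => /wtl_alpha->; apply: eq_mkseq => i; rewrite wt_sumn.
Qed.

Lemma wt_high (c : M) i : (5 <= i)%N -> wt c i = 0%N.
Proof.
move=> i5; rewrite /wt big1 // => j _; apply: alpha_small => //.
by rewrite -ltnS ltn_ord.
Qed.

Local Notation cl c := (cls (mlst c)).

(** All entries from index 5 on vanish, because 24 < 2^5. Hence the comparison of 25 = 24 + 1
    entries is decided by the first five, and [cls_rank] turns it into a comparison of classes. *)
Lemma weight_class (c : M) (w : seq nat) i : posmon c -> (i < 4)%N -> (size w <= 5)%N ->
    mkseq (wvec w) 5 = nth [::] ws i ->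
  (wlt 25 (wt c) (wvec w) = (i < cl c)%N) * (wle 25 (wt c) (wvec w) = (i <= cl c)%N).
Proof.
move=> pc i4 sw wi; have uv j : (5 <= j)%N -> wt c j = wvec w j.
  by move=> j5; rewrite wt_high // /wvec nth_default // (leq_trans sw).
have /allP/(_ (mlst c)) := cls_rank; rewrite mlst_comps => /(_ pc)/allP/(_ i).
rewrite mem_iota => /(_ i4)/andP[/eqP lt_i /eqP eq_i].
rewrite /wle (@wlt_ltl 5) // (@weq_eql 5) // -wt_wtl // wi lt_i eq_i.
by split=> //; rewrite [RHS]leq_eqVlt orbC eq_sym.
Qed.

(** For x even and y odd, y - x is odd and C(x, y - x) is even by Lucas; the finite table is checked
    directly. *)
Lemma posts_odd x y : y \in nth [::] posts x -> odd y -> odd x.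
Proof.
have H : all (fun x => all (fun y => odd y ==> odd x) (nth [::] posts x)) (iota 0 25).
  by vm_compute.
case: (ltnP x 25) => x25; last by rewrite nth_default.
by have /allP/(_ x) := H; rewrite mem_iota => /(_ x25)/allP yH /yH/implyP.
Qed.

Lemma sqterms_odd a n b : b \in sqterms a n -> (count odd b <= count odd a)%N.
Proof.
rewrite mem_sqterms => /andP[+ _]; elim: a b => [|x a IHa] [|y b] //= /andP[/posts_odd yx /IHa].
by apply: leq_add; case: (odd y) yx => // ->.
Qed.

(** The first weight entry counts the odd exponents, and it is 4 in all four weights. *)
Lemma cls_odd b : in_range b -> (cls b < 4)%N -> count odd b = 4%N.
Proof.
move=> rb cb; have hb : has (eql (wtl b)) ws by rewrite has_find.
have : nth 0%N (wtl b) 0 = 4%N.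
  rewrite (eqlP (nth_find [::] hb)) -/(cls b).
  by case: (cls b) cb => [|[|[|[|n]]]].
rewrite wtl_alpha // nth_mkseq // => <-; rewrite -sumn_count; congr sumn.
by apply: eq_map => x; rewrite /alpha divn1 modn2.
Qed.

(** * Normal forms *)

Local Notation sl := (fun l : seq nat => smono (behead l)).

(** The modulus of [dim_normal_form] for n = 4; class 4 collects the positive monomials below all
    four weights. *)
Definition low : {vspace Pd 5 24} :=
  (hitd 5 24 :&: mspan (@posmon 5 24) + mspan (fun c : M => posmon c && (4 <= cl c)%N))%VS.

Lemma sum_row (g : seq nat -> Pd 5 24) a :
  \sum_(x <- row a) g x = \sum_(l <- sqterms a 24 | (cls l < 4)%N) g (label l).
Proof.
rewrite (sum_xsum (@addPP 5 24)) big_map.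
under eq_bigr do rewrite big_seq1.
by rewrite big_filter big_map; apply: eq_bigl => l; rewrite ltbE.
Qed.

Lemma mem_rows r : reflect
  (exists2 a : Expo 5 24,
     [/\ (edeg a < 24)%N, in_range (lst a) & (4 <= count odd (lst a))%N] & r = row (lst a))
  (r \in rows).
Proof.
apply: (iffP mapP) => [[l /flatten_mapP[n]]|[a [a24 ar a4] ->]].
  rewrite mem_rev mem_iota mem_filter mem_comps lebE.
  move=> n24 /andP[l4 /and3P[/eqP sl lr /eqP ln]] ->.
  have [|a al] := @lst_surj 5 24 l sl; first by apply: sub_all lr => x /andP[].
  by exists a; rewrite ?al // -sumn_lst al ln.
exists (lst a) => //; apply/flatten_mapP; exists (edeg a); first by rewrite mem_rev mem_iota.
by rewrite mem_filter lebE a4 mem_comps size_lst ar sumn_lst !eqxx.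
Qed.

Lemma row_low r : r \in rows -> \sum_(x <- r) sl x \in low.
Proof.
case/mem_rows=> a [a24 ar a4] ->; rewrite sum_row /=.
have a_gt0 : all (fun x => 0 < x)%N (lst a) by apply: sub_all ar => x /andP[].
have := Sqmon_smono a_gt0; rewrite (bigID (fun l => cls l < 4)%N) /= => SqE.
(* The row is the positive hit element [Sqmon a] corrected by its terms of class 4, and [low]
   contains both. *)
have -> : \sum_(l <- sqterms (lst a) 24 | (cls l < 4)%N) smono l =
    Sqmon a + \sum_(l <- sqterms (lst a) 24 | ~~ (cls l < 4)%N) smono l.
  by rewrite SqE -addrA addPP addr0.
apply: memv_add; first rewrite memv_cap; first (apply/andP; split).
- by apply/memv_span/map_f; rewrite mem_filter a24 mem_enum.
- rewrite Sqmon_smono // big_seq memv_suml // => l /sqterms_range[_ lr].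
  by apply: mem_smono => c cE; rewrite -in_range_lst cE.
rewrite big_seq_cond memv_suml // => l /andP[/sqterms_range[_ lr] l4].
by apply: mem_smono => c cE; rewrite -in_range_lst cE lr leqNgt.
Qed.

Section NormalForm.
Variable m : rules.
Hypotheses (m_sound : sound sl low m) (m_check : check_reduced labels rows m).

(** Sending monomials with a zero exponent to 0 respects hits: the monomials of [Sqmon a] are all
    positive if [a] is, and none is otherwise. *)
Definition nf (c : M) : Pd 5 24 :=
  if posmon c && (cl c < 4)%N then \sum_(x <- reduce m (label (mlst c))) sl x else 0.

Lemma mem_labels (c : M) : posmon c -> (cl c < 4)%N -> label (mlst c) \in labels.
Proof. by move=> pc c4; rewrite mem_filter ltbE c4 map_f // mlst_comps. Qed.

Lemma nf_Sqmon (a : Expo 5 24) : (edeg a < 24)%N -> mext nf (Sqmon a) = 0.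
Proof.
move=> a24; pose g l := if in_range l && (cls l < 4)%N then \sum_(x <- reduce m (label l)) sl x else 0.
transitivity (\sum_(l <- sqterms (lst a) 24) g l).
  rewrite sum_sqterms [RHS]big_mkcond; apply: eq_bigr => c _.
  rewrite /g /nf in_range_lst; case: (boolP (posmon c)) => [pc|_] /=; last first.
    by rewrite scaler0 if_same.
  by rewrite Sqmon_coef //; case: ifP => _; case: ifP => _; rewrite ?scale1r ?scale0r.
(* If [a] has a zero exponent or fewer than four odd ones, no term falls in the four classes;
   otherwise its row is among those checked to reduce to zero. *)
case: (boolP (in_range (lst a) && (4 <= count odd (lst a))%N)) => [/andP[ar a4]|na]; last first.
  rewrite big1_seq // => l /andP[_ la]; rewrite /g; case: ifP => // /andP[lr l4].
  have [a_gt0 _] := sqterms_range la.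
  case/negP: na; have := sqterms_odd la; rewrite (cls_odd lr l4) => ->; rewrite andbT.
  have -> : in_range (lst a) = all (fun x => 0 < x)%N (lst a); last by [].
  by rewrite !all_lst; apply: eq_forallb => j; rewrite -[(_ <= 24)%N]ltnS ltn_ord andbT.
have /and3P[/allP/(_ (row (lst a))) + _ _] := m_check.
have -> : row (lst a) \in rows by apply/mem_rows; exists a.
move=> /(_ isT)/nilP/(congr1 (fun s => \sum_(x <- s) sl x)).
rewrite big_nil (sum_xsum (@addPP 5 24)) big_map sum_row => sum0.
rewrite -[RHS]sum0 [RHS]big_mkcond; apply: eq_big_seq => l la.
by rewrite /g; have [_ ->] := sqterms_range la.
Qed.

Lemma nf_hitd x : x \in hitd 5 24 -> mext nf x = 0.
Proof.
suff /subvP H : (hitd 5 24 <= lker (linfun (mext nf)))%VS.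
  by move/H; rewrite memv_ker lfunE => /eqP.
apply/span_subvP=> y /mapP[a]; rewrite mem_filter => /andP[a24 _] ->{y}.
by rewrite memv_ker lfunE /= nf_Sqmon.
Qed.

Local Notation free c := (is_free m (label (mlst c))).

Lemma nf_low (c : M) : posmon c -> mono c + nf c \in low.
Proof.
move=> pc; rewrite /nf pc /=; case: ltnP => c4.
  by rewrite -smono_mlst; apply: (sound_reduce (@addPP 5 24) (label (mlst c)) m_sound).
rewrite addr0; apply: (subvP (addvSr _ _)); apply: mem_mono_mspan.
by rewrite pc.
Qed.

Lemma nf_mspan (b : M) : posmon b ->
  nf b \in mspan (fun c : M => [&& posmon c, free c & (cl b <= cl c < 4)%N]).
Proof.
move=> pb; rewrite /nf pb /=; case: ltnP => b4; last exact: mem0v.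
have /and3P[_ /allP/(_ _ (mem_labels pb b4))/allP red _] := m_check.
rewrite big_seq memv_suml // => x /red /and5P[].
rewrite lebE ltbE => bx x4 fx /eqlP xE x_gt0; apply: mem_smono => c cE.
(* By [xE], [x] is the label of its own tail, so the head read by the check is the true class. *)
rewrite cE -xE fx; have -> : cls (behead x) = head 0%N x by rewrite [in RHS]xE.
rewrite bx x4 /= andbT; rewrite -in_range_lst all_lst.
move: x_gt0; rewrite -cE all_lst => /forallP c_gt0; apply/forallP=> j.
by rewrite -[(_ <= 24)%N]ltnS ltn_ord andbT -ltbE.
Qed.

Lemma nf_free (c : M) : posmon c -> (cl c < 4)%N -> free c -> nf c = mono c.
Proof.
rewrite /nf => -> -> /=; rewrite /is_free /reduce; case: PM.find => // _.
by rewrite big_seq1 smono_mlst.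
Qed.

Lemma card_free i : (i < 4)%N ->
  #|[pred c : M | [&& posmon c, free c & cl c == i]]| = nth 0%N [:: 75; 145; 1; 390]%N i.
Proof.
move=> i4; rewrite (card_posmon (fun l => is_free m (label l) && (cls l == i))).
have /and3P[_ _ /eqlP <-] := m_check.
have i_iota : (i < size (iota 0 4))%N by [].
rewrite (nth_map 0%N _ _ i_iota) (nth_iota _ _ i4) add0n count_filter count_map.
apply: eq_count => l /=; rewrite ltbE eqbE andbC.
by case: eqP => [->|] //=; rewrite i4 andbT.
Qed.

Lemma dimQPplus_check (w : seq nat) i : degw w = 24%N -> (size w <= 5)%N -> (i < 4)%N ->
  mkseq (wvec w) 5 = nth [::] ws i -> dimQPplus 5 w = nth 0%N [:: 75; 145; 1; 390]%N i.
Proof.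
move=> dw sw i4 wi; rewrite -card_free //.
rewrite -(dim_normal_form (cl := fun c : M => cl c) i4 nf_low nf_hitd nf_mspan nf_free).
(* The ambient space depends on [degw w], so the degree is generalized before it is replaced by
   24. *)
rewrite /dimQPplus /Pw /Pwminus; move: (degw w) dw => d dw; rewrite {d}dw in sw *.
have ge_i : (Pplus 5 24 :&: mspan (fun c : M => wle 25 (wt c) (wvec w)))%VS =
    mspan (fun c : M => posmon c && (i <= cl c)%N).
  rewrite mspanI; apply: eq_mspan => c /=; case: (boolP (posmon c)) => //= pc.
  by rewrite (weight_class pc i4 sw wi).
have gt_i : (Pplus 5 24 :&: mspan (fun c : M => wlt 25 (wt c) (wvec w)))%VS =
    mspan (fun c : M => posmon c && (i < cl c)%N).
  rewrite mspanI; apply: eq_mspan => c /=; case: (boolP (posmon c)) => //= pc.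
  by rewrite (weight_class pc i4 sw wi).
by rewrite -capvA ge_i gt_i.
Qed.

End NormalForm.

Lemma normal_forms_sound : sound sl low (normal_forms labels rows).
Proof. exact/(sound_backsub (@addPP 5 24))/(sound_gauss (@addPP 5 24))/row_low. Qed.

Local Close Scope ring_scope.

Theorem theorem3p4 :
  dimQPplus 5 [:: 4; 4; 3] = 75 /\
  dimQPplus 5 [:: 4; 4; 1; 1] = 145 /\
  dimQPplus 5 [:: 4; 2; 2; 1] = 390 /\
  dimQPplus 5 [:: 4; 2; 4] = 1.
Proof.
have dimQ := dimQPplus_check normal_forms_sound check_true.
split; [|split; [|split]].
- by apply: (dimQ _ 0%N); rewrite // /degw !big_ord_recl big_ord0.
- by apply: (dimQ _ 1%N); rewrite // /degw !big_ord_recl big_ord0.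
(* Classes follow decreasing weight and (4,2,4) > (4,2,2,1), so the last two indices are swapped. *)
- by apply: (dimQ _ 3%N); rewrite // /degw !big_ord_recl big_ord0.
by apply: (dimQ _ 2%N); rewrite // /degw !big_ord_recl big_ord0.
Qed.
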